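(* Let $(\Omega,\mathcal F,P)$ be an atomless probability space and let $X,Y\in\mathcal L_1(\Omega,\mathcal F,P)$. Then $$\operatorname{dist}(X,A_2(Y))\ \ge\ \sup_{p\in[0,1]}\big(F_Y^{(-2)}(p)-F_X^{(-2)}(p)\big)\ =\ \sup_{\eta\in\mathbb R}\big(F_X^{(2)}(\eta)-F_Y^{(2)}(\eta)\big).$$
   Context: $\mathcal L_1(\Omega,\mathcal F,P)$ is the space of integrable real random variables. For a random variable $Z$: $F_Z(\eta)=P(Z\le\eta)$; $F_Z^{(-1)}(p)=\inf\{\eta: F_Z(\eta)\ge p\}$ for $p\in(0,1)$; for integrable $Z$, $F_Z^{(2)}(\eta)=\int_{-\infty}^\eta F_Z(t)\,dt=\mathbb E[\max(\eta-Z,0)]$ for $\eta\in\mathbb R$; $F_Z^{(-2)}(p)=\int_0^pF_Z^{(-1)}(t)\,dt$ for $0<p\le1$ and $F_Z^{(-2)}(0)=0$. Second-order stochastic dominance: $Z\succeq_{(2)}Y$ iff $F_Z^{(2)}(\eta)\le F_Y^{(2)}(\eta)$ for all $\eta\in\mathbb R$ (equivalently $F_Z^{(-2)}(p)\ge F_Y^{(-2)}(p)$ for all $p\in[0,1]$). $A_2(Y)=\{Z\in\mathcal L_1(\Omega,\mathcal F,P): Z\succeq_{(2)}Y\}$. $W_1(X,Z)=\int_0^1|F_Z^{(-1)}(p)-F_X^{(-1)}(p)|\,dp$ and $\operatorname{dist}(X,A_2(Y))=\inf\{W_1(X,Z): Z\in A_2(Y)\}$. *)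

(* Defs.v *)
(* Conventions (MathComp-Analysis): all integrals and the derived quantities
   take values in \bar R, so that no default value is hidden behind a [fine];
   for integrable random variables they are finite. *)
From mathcomp Require Export all_boot all_order all_algebra.
From mathcomp Require Export all_classical all_reals all_analysis.

Set Implicit Arguments.
Unset Strict Implicit.
Unset Printing Implicit Defensive.

Import Order.TTheory GRing.Theory Num.Theory.
Import numFieldNormedType.Exports.

Local Open Scope classical_set_scope.
Local Open Scope ring_scope.
Local Open Scope ereal_scope.

Definition atomless (d : measure_display) (T : measurableType d)
    (R : realType) (mu : {measure set T -> \bar R}) : Prop :=
  forall A : set T, measurable A -> 0 < mu A ->
    exists B : set T, [/\ measurable B, B `<=` A & 0 < mu B < mu A].

Section stochastic_dominance.
Context (d : measure_display) (T : measurableType d) (R : realType)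
  (P : probability T R).
Implicit Types X Y Z : {RV P >-> R}.

(* Only meaningful for 0 < p < 1, where the set is nonempty and bounded below;
   elsewhere [inf] may return its default value, so the integrals below range
   over open intervals. *)
Definition quantile Z (p : R) : R := inf [set eta : R | p%:E <= cdf Z eta].

Definition F2 Z (eta : R) : \bar R :=
  \int[lebesgue_measure]_(t in `]-oo, eta]) cdf Z t.

(* At p = 0 the domain is empty and the value is 0. *)
Definition F2inv Z (p : R) : \bar R :=
  \int[lebesgue_measure]_(t in `]0%R, p[) (quantile Z t)%:E.

Definition ssd Z Y : Prop := forall eta : R, F2 Z eta <= F2 Y eta.

Definition A2 Y : set {RV P >-> R} :=
  [set Z : {RV P >-> R} | (Z : T -> R) \in Lfun P 1 /\ ssd Z Y].

Definition W1 X Z : \bar R :=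
  \int[lebesgue_measure]_(p in `]0%R, 1%R[)
    (`|quantile Z p - quantile X p|%R)%:E.

Definition dist X (A : set {RV P >-> R}) : \bar R :=
  ereal_inf [set W1 X Z | Z in A].

End stochastic_dominance.

(* Main.v *)
(* [F2 Z] and [F2inv Z] are convex conjugates of each other. The quantile
   function, seen as a random variable on ]0, 1[, has the law of [Z], so that
   [F2 Z eta] is both [E max(eta - Z, 0)] and the integral of
   [max(eta - quantile Z t, 0)] over ]0, 1[. Comparing the latter with
   [p * eta - F2inv Z p], the integral of [eta - quantile Z t] over ]0, p[,
   gives the Fenchel-Young inequality [p * eta <= F2inv Z p + F2 Z eta], which
   is an equality at [p = F_Z(eta)] and at [eta = quantile Z p]. These two cases
   of equality bound each supremum by the other and turn dominance
   [F2 Z <= F2 Y] into [F2inv Y <= F2inv Z]; the levels p = 0, 1, at which no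
   eta need attain equality, follow by continuity of [F2inv]. Finally
   [F2inv Z p - F2inv X p] is at most the W1 distance between X and Z. *)
Require Import Defs.
From HB Require Import structures.
From mathcomp Require Import all_boot all_order all_algebra.
From mathcomp Require Import all_classical all_reals all_analysis.
From mathcomp Require Import measurable_realfun.
From mathcomp Require Import lra.
Import Order.TTheory GRing.Theory Num.Theory.
Import numFieldNormedType.Exports.
Local Open Scope classical_set_scope.
Local Open Scope ring_scope.
Local Open Scope ereal_scope.

Section quantile.
Context {d} {T : measurableType d} {R : realType} {P : probability T R}.
Implicit Types X Y Z : {RV P >-> R}.

(** * The quantile function as generalized inverse of the cdf *)

(** The limits of the cdf at +oo and -oo make the defining set nonempty and bounded below, and
    right-continuity of the cdf puts the infimum in the set. *)
Lemma quantile_le Z (p eta : R) : (0 < p < 1)%R ->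
  (quantile Z p <= eta)%R = (p%:E <= cdf Z eta).
Proof.
move=> /andP[p0 p1]; rewrite /quantile; set S := [set _ | _].
have S0 : S !=set0.
  have : \forall x \near +oo%R, p%:E < cdf Z x.
    have p1' : p%:E < 1 by rewrite lte_fin.
    exact: (cvg_cdfy1 Z (open_ereal_gt' p1')).
  move=> [M [_ +]] => /(_ (M + 1)%R) h; exists (M + 1)%R.
  by apply/ltW/h; rewrite ltrDl.
have Slb : has_lbound S.
  have : \forall x \near -oo%R, cdf Z x < p%:E.
    have p0' : 0 < p%:E by rewrite lte_fin.
    exact: (cvg_cdfNy0 Z (open_ereal_lt' p0')).
  move=> [M [_ h]]; exists M => x /= Sx; rewrite leNgt; apply/negP => /h.
  by rewrite ltNge Sx.
apply/idP/idP => [qeta|peta]; last exact: ge_inf.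
have /cvg_lim <- // := @cdf_right_continuous _ _ _ _ Z eta.
apply: lime_ge; first by apply/cvg_ex; eexists; exact: cdf_right_continuous.
near=> x.
(* Every x > eta exceeds the infimum, hence lies above some y in S; the bound p <= cdf Z x then
   passes to the right limit at eta. *)
have /(inf_lt S0)[y Sy yx] : (inf S < x)%R by apply: (le_lt_trans qeta).
exact: le_trans Sy (cdf_nondecreasing _ (ltW yx)).
Unshelve. all: by end_near. Qed.

Lemma quantile_nondecreasing Z :
  {in `]0%R, 1%R[ &, {homo quantile Z : x y / (x <= y)%R}}.
Proof.
move=> x y; rewrite !in_itv/= => x01 y01 xy; rewrite quantile_le//.
by rewrite (le_trans (y := y%:E)) ?lee_fin// -quantile_le.
Qed.

(** By [quantile_le], the preimage of a ray ]x, +oo[ is the part of ]0, 1[ above the value of the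
    cdf at x. *)
Lemma measurable_quantile Z :
  measurable_fun (`]0%R, 1%R[ : set (measurableTypeR R)) (quantile Z).
Proof.
move=> mD; apply: (measurability _ (RGenOInfty.measurableE R)) => //.
move=> _ [_ [x ->] <-].
rewrite [X in measurable X](_ : _ =
    `]0%R, 1%R[ `&` `]fine (cdf Z x), +oo[); first exact: measurableI.
apply/seteqP; split => t /= [t01]; rewrite !in_itv/= !andbT => tx;
  split => //; move: tx; rewrite !ltNge quantile_le// -[X in _ <= X]fineK//;
  exact: fin_num_measure.
Qed.

(* Extended by 0 to a total measurable function, hence a random variable. *)
Definition quantile01 Z : measurableTypeR R -> R := quantile Z \_ `]0%R, 1%R[.

Lemma measurable_quantile01 Z : measurable_fun setT (quantile01 Z).
Proof.
apply: (measurable_restrictT _ _).1; first exact: measurable_itv.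
exact: measurable_quantile.
Qed.

Lemma quantile01E Z (p : R) :
  p \in `]0%R, 1%R[ -> quantile01 Z p = quantile Z p.
Proof. by move=> p01; rewrite /quantile01 patchE mem_set. Qed.

HB.instance Definition _ Z :=
  isMeasurableFun.Build _ _ _ _ (quantile01 Z) (measurable_quantile01 Z).

(** * The law of the quantile function under the uniform probability *)

Let U : probability (measurableTypeR R) R := uniform_prob (@ltr01 R).

Lemma integral_uniform01 (f : measurableTypeR R -> \bar R) :
  measurable_fun setT f -> (forall x, 0 <= f x) ->
  \int[U]_x f x = \int[lebesgue_measure]_(x in `]0%R, 1%R[) f x.
Proof.
move=> mf f0; rewrite integral_uniform// subr0 invr1 mul1e.
by rewrite integral_itv_bndoo//; exact: measurable_funTS.
Qed.

(** Inverse transform sampling: on ]0, 1[ the event quantile Z t <= eta reads t <= cdf Z eta, a set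
    of Lebesgue measure cdf Z eta. *)
Lemma cdf_quantile01 Z (eta : R) :
  cdf (quantile01 Z : {RV U >-> R}) eta = cdf Z eta.
Proof.
rewrite /cdf [LHS]/distribution /pushforward -/(cdf Z eta).
have mQ : measurable (quantile01 Z @^-1` `]-oo, eta]).
  by rewrite -[X in measurable X]setTI; exact: measurable_quantile01.
have Ffin : cdf Z eta \is a fin_num by exact: fin_num_measure.
have F0 : (0 <= fine (cdf Z eta))%R by exact: fine_ge0.
have F1 : (fine (cdf Z eta) <= 1)%R by rewrite -lee_fin fineK// cdf_le1.
rewrite -[X in U X]setIT -integral_indic// integral_uniform01//; last 1 first.
  by apply/measurable_EFinP; exact: measurable_indic.
transitivity (\int[lebesgue_measure]_(t in `]0%R, 1%R[)
    (\1_(`]-oo, fine (cdf Z eta)] : set R) t)%:E).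
  apply: eq_integral.
  move=> t /set_mem t01 /=; rewrite !indicE; congr (_%:R%:E); congr nat_of_bool.
  apply/idP/idP => /set_mem/=; rewrite ?in_itv/= => tE; apply/mem_set => /=;
    move: tE; rewrite ?in_itv/= quantile01E// quantile_le//;
    by rewrite -[X in _ <= X]fineK.
rewrite integral_indic//.
(* For the value 1 the intersection is ]0, 1[, open on the right; otherwise it contains its right
   endpoint. *)
have [F1'|F1'] := eqVneq (fine (cdf Z eta)) 1%R.
  rewrite setIidr ?F1'; last first.
    by move=> x /=; rewrite !in_itv/= => /andP[_ /ltW].
  by rewrite [LHS]lebesgue_measure_itv/= lte_fin ltr01 -EFinB subr0 -F1' fineK.
rewrite (_ : _ `&` _ = `]0%R, fine (cdf Z eta)]%classic); last first.
  apply/seteqP; split => x /=; rewrite !in_itv/=.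
    by move=> [-> /andP[->]].
  move=> /andP[-> xF]; rewrite xF; split => //=.
  by rewrite (le_lt_trans xF)// lt_neqAle F1'.
rewrite [LHS]lebesgue_measure_itv/= lte_fin lt_neqAle F0 andbT -EFinB subr0 eq_sym.
by rewrite -[RHS]fineK//; case: eqVneq => //= ->.
Qed.

(** The rays ]x, +oo[ form a pi-system generating the Borel sets, and on them the two laws agree by
    equality of the cdfs. *)
Lemma distribution_quantile01 Z (A : set R) : measurable A ->
  distribution U (quantile01 Z) A = distribution P Z A.
Proof.
apply: (measure_unique (@RGenOInfty.G R)
  (fun n => `](- n%:R)%R, +oo[%classic)).
- exact: RGenOInfty.measurableE.
- move=> _ _ [x ->] [y ->]; exists (Num.max x y); apply/seteqP.
  split=> t /=; rewrite !in_itv/= !andbT gt_max; first by move=> [-> ->].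
  by move=> /andP[].
- by move=> n; exists (- n%:R)%R.
- apply/seteqP; split=> // x _; exists (Num.bound `|x|%R) => //=.
  rewrite in_itv/= andbT ltrNl (le_lt_trans (ler_norm _))// normrN.
  exact: archi_boundP.
- move=> _ [x ->].
  transitivity (ccdf (quantile01 Z : {RV U >-> R}) x); first by [].
  by rewrite ccdf_1_cdf cdf_quantile01 -ccdf_1_cdf.
- by move=> n; rewrite -ge0_fin_numE// fin_num_measure.
Qed.

(** Both sides are the integral of f against the common law of [Z] and [quantile01 Z]. *)
Lemma integral_quantile Z (f : R -> \bar R) :
  measurable_fun setT f -> (forall x, 0 <= f x) ->
  \int[lebesgue_measure]_(t in `]0%R, 1%R[) f (quantile Z t) =
    \int[P]_w f (Z w).
Proof.
move=> mf f0; rewrite -[RHS](ge0_integral_distribution Z)//.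
transitivity (\int[distribution U (quantile01 Z)]_y f y); last first.
  by apply: eq_measure_integral => A mA _; exact: distribution_quantile01.
rewrite ge0_integral_distribution//= integral_uniform01//.
  by apply: eq_integral => t /set_mem t01 /=; rewrite quantile01E.
exact: measurableT_comp.
Qed.

(** * Expected shortfall and integrability *)

(** Tonelli on the region Z w <= t <= eta: for t <= eta the section at t has probability cdf Z t,
    and the section at w has length max(eta - Z w, 0). *)
Lemma F2E Z (eta : R) : F2 Z eta = \int[P]_w (Num.max (eta - Z w) 0)%:E.
Proof.
pose A := [set z : T * measurableTypeR R | Z z.1 <= z.2 <= eta]%R.
have mA : measurable A.
  rewrite (_ : A = (setT `&` [set z | Z z.1 <= z.2]%R) `&`
      (setT `&` [set z | z.2 <= eta]%R)); last first.
    apply/seteqP; split => z /=; first by move=> /andP[].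
    by move=> [[_ h1] [_ h2]]; exact/andP.
  by apply: measurableI; apply: measurable_fun_le => //; exact: measurableT_comp.
have := indic_fubini_tonelli P (@lebesgue_measure R) mA.
rewrite (indic_fubini_tonelli_FE _ mA) (indic_fubini_tonelli_GE _ mA) => e.
rewrite /F2 [LHS]integral_mkcond.
transitivity (\int[lebesgue_measure]_t P (ysection A t)).
  apply: eq_integral => t _; rewrite patchE mem_setE in_itv/=.
  case: ifPn => [teta|/negbTE teta].
    rewrite /cdf /distribution /pushforward; congr (P _); apply/seteqP.
    by split => w; rewrite /ysection/= inE /A/= in_itv/= teta andbT.
  rewrite (_ : ysection A t = set0) ?measure0//; apply/seteqP.
  by split => w //; rewrite /ysection/= inE /A/= teta andbF.
rewrite -[LHS]e; apply: eq_integral => w _ /=.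
rewrite (_ : xsection A w = `[Z w, eta]%classic); last first.
  by apply/seteqP; split => t; rewrite /xsection /= ?inE/= ?in_itv/= ?inE.
rewrite lebesgue_measure_itv /= lte_fin.
case: ltP => h; first by rewrite max_l ?EFinB// subr_ge0 ltW.
by rewrite max_r// subr_le0.
Qed.

Lemma F2_quantile Z (eta : R) :
  F2 Z eta = \int[lebesgue_measure]_(t in `]0%R, 1%R[)
    (Num.max (eta - quantile Z t) 0)%:E.
Proof.
rewrite F2E (integral_quantile Z (fun x => (Num.max (eta - x) 0)%:E))//.
  by apply/measurable_EFinP; apply: measurable_maxr => //; exact: measurable_funB.
by move=> x; rewrite lee_fin le_max lexx orbT.
Qed.

Lemma integrable_quantile01 Z : (Z : T -> R) \in Lfun P 1 ->
  lebesgue_measure.-integrable setT (EFin \o quantile01 Z).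
Proof.
move=> /Lfun1_integrable/integrableP[_ Zoo]; apply/integrableP; split.
  by apply/measurable_EFinP; exact: measurable_quantile01.
rewrite (_ : \int[_]_x _ =
    \int[lebesgue_measure]_(t in `]0%R, 1%R[) `|(quantile Z t)%:E|).
  rewrite (integral_quantile Z (fun x => `|x%:E|))//.
  by apply: measurableT_comp => //; exact/measurable_EFinP.
rewrite [RHS]integral_mkcond; apply: eq_integral => t _ /=.
by rewrite /quantile01 !patchE; case: ifPn => // _; rewrite normr0.
Qed.

Lemma integrable_quantile Z : (Z : T -> R) \in Lfun P 1 ->
  lebesgue_measure.-integrable `]0%R, 1%R[ (EFin \o quantile Z).
Proof.
move=> /integrable_quantile01 h.
apply: (@eq_integrable _ _ _ lebesgue_measure `]0%R, 1%R[ (measurable_itv _)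
  (EFin \o quantile01 Z)).
  by move=> t /set_mem t01 /=; rewrite quantile01E.
exact: integrableS h.
Qed.

Lemma F2_fin_num Z (eta : R) : (Z : T -> R) \in Lfun P 1 ->
  F2 Z eta \is a fin_num.
Proof.
move=> /Lfun1_integrable Z1.
have : P.-integrable setT (EFin \o (fun w => eta - Z w)%R).
  rewrite (_ : _ \o _ = (EFin \o cst eta) \- (EFin \o Z)).
    by apply: integrableB => //; exact: finite_measure_integrable_cst.
  by apply/funext => w /=; rewrite EFinB.
move=> /integrableP[mf].
rewrite F2E ge0_fin_numE; last first.
  by apply: integral_ge0 => w _; rewrite lee_fin le_max lexx orbT.
apply: le_lt_trans; apply: ge0_le_integral => //.
- by move=> w _; rewrite lee_fin le_max lexx orbT.
- apply/measurable_EFinP; apply: measurable_maxr => //.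
  exact: measurable_funB.
- exact: measurableT_comp.
- by move=> w _; rewrite /= lee_fin ge_max normr_ge0 ler_norm.
Qed.

Lemma integrable_shortfall Z (eta : R) : (Z : T -> R) \in Lfun P 1 ->
  lebesgue_measure.-integrable `]0%R, 1%R[
    (fun t => (Num.max (eta - quantile Z t) 0)%:E).
Proof.
move=> Z1; apply/integrableP; split.
  apply/measurable_EFinP; apply: measurable_maxr => //.
  by apply: measurable_funB => //; exact: measurable_quantile.
under eq_integral do rewrite gee0_abs ?lee_fin ?le_max ?lexx ?orbT//.
by rewrite -F2_quantile -ge0_fin_numE ?F2_fin_num// integral_ge0.
Qed.

Lemma integrable_quantileS Z (p : R) : (Z : T -> R) \in Lfun P 1 -> (p <= 1)%R ->
  lebesgue_measure.-integrable `]0%R, p[ (EFin \o quantile Z).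
Proof.
move=> Z1 p1; apply: integrableS (integrable_quantile Z Z1) => //.
by apply: subset_itvl; rewrite bnd_simp.
Qed.

Lemma F2inv_fin_num Z p : (Z : T -> R) \in Lfun P 1 -> (p <= 1)%R ->
  F2inv Z p \is a fin_num.
Proof.
by move=> Z1 p1; apply: integrable_fin_num => //; exact: integrable_quantileS.
Qed.

(** * The Fenchel-Young inequality and its cases of equality *)

(** The integrand is cut off outside ]0, p[ but integrated over ]0, 1[, to be compared pointwise
    with the shortfall integrand of [F2_quantile]. *)
Lemma F2inv_truncated_integral Z (p eta : R) : (Z : T -> R) \in Lfun P 1 -> (0 <= p <= 1)%R ->
  lebesgue_measure.-integrable `]0%R, 1%R[
    ((fun t => (eta - quantile Z t)%:E) \_ `]0%R, p[) /\
  (p * eta)%:E = F2inv Z p + \int[lebesgue_measure]_(t in `]0%R, 1%R[)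
    ((fun t => (eta - quantile Z t)%:E) \_ `]0%R, p[) t.
Proof.
move=> Z1 /andP[p0 p1].
have mp : lebesgue_measure (`]0%R, p[%classic : set R) = p%:E.
  rewrite lebesgue_measure_itv/= lte_fin lt_neqAle p0 andbT -EFinB subr0 eq_sym.
  by case: eqVneq => [->|].
have cE : lebesgue_measure.-integrable `]0%R, p[ (EFin \o cst eta).
  apply/integrableP; split; first exact/measurable_EFinP.
  rewrite (@integral_cst _ _ _ _ _ _ `|eta|%:E)// [X in _ * X]mp.
  by rewrite -EFinM ltry.
have qE := integrable_quantileS Z p Z1 p1.
have pE : `]0%R, 1%R[ `&` `]0%R, p[ = `]0%R, p[%classic :> set R.
  by rewrite setIidr//; apply: subset_itvl; rewrite bnd_simp.
split.
  apply/integrable_restrict => //=; rewrite pE.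
  rewrite (_ : (fun t : R => _) = (EFin \o cst eta) \- (EFin \o quantile Z)).
    exact: integrableB.
  by apply/funext => t /=; rewrite EFinB.
rewrite -integral_mkcondr pE.
rewrite [X in _ + X](_ : _ =
    \int[lebesgue_measure]_(t in `]0%R, p[) (cst eta t)%:E - F2inv Z p); last first.
  rewrite -integralB_EFin//.
rewrite [RHS]addeC subeK ?F2inv_fin_num//.
by rewrite (@integral_cst _ _ _ _ _ _ eta%:E)// [X in _ * X]mp mulrC EFinM.
Qed.

Lemma F2_young Z (p eta : R) : (Z : T -> R) \in Lfun P 1 -> (0 <= p <= 1)%R ->
  (p * eta)%:E <= F2inv Z p + F2 Z eta.
Proof.
move=> Z1 p01; have [intE ->] := F2inv_truncated_integral Z p eta Z1 p01.
rewrite F2_quantile leeD2l//; apply: le_integral => //.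
  exact: integrable_shortfall.
move=> t _; rewrite patchE; case: ifPn => _.
  by rewrite lee_fin le_max lexx.
by rewrite lee_fin le_max lexx orbT.
Qed.

(** The last two hypotheses make eta - quantile Z t nonnegative before p and nonpositive after it,
    so cutting off at p amounts to taking the positive part, almost everywhere. *)
Lemma F2_young_eq Z (p eta : R) : (Z : T -> R) \in Lfun P 1 -> (0 <= p <= 1)%R ->
  (forall t : R, 0 < t < 1 -> t < p -> quantile Z t <= eta)%R ->
  (forall t : R, 0 < t < 1 -> p < t -> eta <= quantile Z t)%R ->
  (p * eta)%:E = F2inv Z p + F2 Z eta.
Proof.
move=> Z1 p01 lo hi; have [intE ->] := F2inv_truncated_integral Z p eta Z1 p01.
rewrite F2_quantile; congr (_ + _); apply: ae_eq_integral => //.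
- exact: measurable_int intE.
- exact: measurable_int (integrable_shortfall Z eta Z1).
(* At t = p itself the two integrands may differ. *)
exists [set p]; split; [exact: measurable_set1|exact: lebesgue_measure_set1|].
move=> t /= h; apply: contrapT => tp; apply: h; rewrite in_itv/= => t01.
rewrite patchE mem_setE in_itv/=; have [t0 _] := andP t01; rewrite t0/=.
case: ltgtP tp => // [tp _|pt _].
  by rewrite max_l// subr_ge0 lo.
by rewrite max_r// subr_le0 hi.
Qed.

Lemma F2_cdfE Z (eta : R) : (Z : T -> R) \in Lfun P 1 ->
  let p := fine (cdf Z eta) in (p * eta)%:E = F2inv Z p + F2 Z eta.
Proof.
move=> Z1 p; have pE : p%:E = cdf Z eta by rewrite fineK// fin_num_measure.
apply: F2_young_eq => //.
- by rewrite -!lee_fin pE cdf_le1 andbT.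
- by move=> t t01 tp; rewrite quantile_le// -pE lee_fin ltW.
(* A value quantile Z t < eta would give t <= cdf Z eta = p. *)
- move=> t t01 pt; rewrite leNgt; apply/negP => /ltW.
  by rewrite quantile_le// -pE lee_fin leNgt pt.
Qed.

Lemma F2inv_quantileE Z (p : R) : (Z : T -> R) \in Lfun P 1 -> (0 < p < 1)%R ->
  (p * quantile Z p)%:E = F2inv Z p + F2 Z (quantile Z p).
Proof.
move=> Z1 p01; apply: F2_young_eq => //; first by have /andP[/ltW-> /ltW->] := p01.
- by move=> t t01 /ltW tp; apply: quantile_nondecreasing.
- by move=> t t01 /ltW tp; apply: quantile_nondecreasing.
Qed.

(** * Continuity in the level p and passage to the endpoints *)

(** Presents [F2inv Z] as a primitive of a function integrable on the whole line, whence its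
    continuity. *)
Lemma F2inv_parameterized Z (p : R) : (Z : T -> R) \in Lfun P 1 -> (p <= 1)%R ->
  F2inv Z p = (parameterized_integral lebesgue_measure 0%R p (quantile01 Z))%:E.
Proof.
move=> Z1 p1; have qE := integrable_quantile01 Z Z1.
rewrite /parameterized_integral /Rintegral fineK; last first.
  by apply: integrable_fin_num => //; apply: integrableS qE.
rewrite integral_itv_bndoo; last first.
  by apply/measurable_EFinP; apply: measurable_funTS; exact: measurable_quantile01.
apply: eq_integral => t /set_mem/=; rewrite in_itv/= => /andP[t0 tp].
by rewrite quantile01E// in_itv/= t0 (lt_le_trans tp).
Qed.

(** Both primitives are continuous on [0, 1], so a bound at interior levels passes to 0 and 1 by
    one-sided limits. *)
Lemma F2inv_sub_le X Y (c : \bar R) :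
  (X : T -> R) \in Lfun P 1 -> (Y : T -> R) \in Lfun P 1 ->
  (forall p : R, (0 < p < 1)%R -> F2inv Y p - F2inv X p <= c) ->
  forall p : R, (0 <= p <= 1)%R -> F2inv Y p - F2inv X p <= c.
Proof.
move=> X1 Y1; case: c => [c| |] h p /andP[p0 p1]; last 2 first.
- by rewrite leey.
(* The case c = -oo is absurd, the difference being finite; 1/2 is just some interior level. *)
- have : F2inv Y 2^-1%R - F2inv X 2^-1%R <= -oo.
    by apply: h; rewrite invr_gt0 ltr0n invf_lt1 ?ltr1n ?ltr0n.
  have h2 : (2^-1 <= 1 :> R)%R by rewrite invf_le1 ?ler1n ?ltr0n.
  by rewrite !F2inv_parameterized.
pose I W (x : R) : R :=
  parameterized_integral lebesgue_measure 0%R x (quantile01 W).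
have IC (W : {RV P >-> R}) : (W : T -> R) \in Lfun P 1 ->
    [/\ {in `]0%R, 1%R[, continuous (I W)},
      I W x @[x --> 0^'+] --> I W 0%R & I W x @[x --> 1^'-] --> I W 1%R].
  move=> W1; apply/(continuous_within_itvP _ ltr01).
  apply: parameterized_integral_continuous => //.
  exact: integrableS (integrable_quantile01 W W1).
have {}h x : (0 < x < 1)%R -> (I Y x - I X x <= c)%R.
  move=> x01; have [_ /ltW x1] := andP x01.
  by have := h x x01; rewrite !F2inv_parameterized// -EFinB lee_fin.
rewrite !F2inv_parameterized// -EFinB lee_fin -!/(I _ _).
have [_ Y0 Y1'] := IC Y Y1.
have [_ X0 X1'] := IC X X1.
have [->|p0'] := eqVneq p 0%R.
  apply: (cvgr_to_le (cvgB Y0 X0)); near=> x; apply: h.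
  by apply/andP; split.
have [->|p1'] := eqVneq p 1%R.
  apply: (cvgr_to_le (cvgB Y1' X1')); near=> x; apply: h.
  by apply/andP; split.
by apply: h; rewrite lt_neqAle eq_sym p0' p0 lt_neqAle p1' p1.
Unshelve. all: by end_near. Qed.

(** * Comparison with W1 and between the two suprema *)

Lemma F2inv_le_W1 X Z (p : R) :
  (X : T -> R) \in Lfun P 1 -> (Z : T -> R) \in Lfun P 1 -> (p <= 1)%R ->
  F2inv Z p - F2inv X p <= W1 X Z.
Proof.
move=> X1 Z1 p1.
have XE := integrable_quantileS X p X1 p1; have ZE := integrable_quantileS Z p Z1 p1.
rewrite /F2inv -integralB_EFin//.
apply: (@le_trans _ _ (\int[lebesgue_measure]_(t in `]0%R, p[)
    (`|quantile Z t - quantile X t|%R)%:E)).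
  apply: le_integral => //.
  - exact: integrableB.
  - exact: (integrable_abse (integrableB _ ZE XE)).
  - by move=> t _; rewrite -EFinB lee_fin ler_norm.
apply: ge0_subset_integral => //.
  apply/measurable_EFinP; apply: measurableT_comp => //.
  by apply: measurable_funB; exact: measurable_quantile.
by apply: subset_itvl; rewrite bnd_simp.
Qed.

(** At p = cdf X eta, Fenchel-Young is an equality for X and an inequality for Y; subtract. *)
Lemma F2_sub_le X Y (eta : R) :
  (X : T -> R) \in Lfun P 1 -> (Y : T -> R) \in Lfun P 1 ->
  exists2 p : R, (0 <= p <= 1)%R & F2 X eta - F2 Y eta <= F2inv Y p - F2inv X p.
Proof.
move=> X1 Y1; pose p := fine (cdf X eta).
have p01 : (0 <= p <= 1)%R.
  by rewrite -!lee_fin fineK ?fin_num_measure// cdf_le1 andbT.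
exists p => //; have := F2_young Y p eta Y1 p01; rewrite (F2_cdfE X eta X1) -/p.
have [_ p1] := andP p01.
rewrite -(fineK (F2_fin_num X eta X1)) -(fineK (F2_fin_num Y eta Y1)).
rewrite -(fineK (F2inv_fin_num X p X1 p1)) -(fineK (F2inv_fin_num Y p Y1 p1)).
by rewrite -!EFinB -!EFinD !lee_fin; lra.
Qed.

(** The roles are exchanged: at eta = quantile Y p, equality holds for Y and the inequality is used
    for X. *)
Lemma F2inv_sub_le_F2 X Y (p : R) :
  (X : T -> R) \in Lfun P 1 -> (Y : T -> R) \in Lfun P 1 -> (0 < p < 1)%R ->
  F2inv Y p - F2inv X p <= F2 X (quantile Y p) - F2 Y (quantile Y p).
Proof.
move=> X1 Y1 p01; set eta := quantile Y p.
have p01' : (0 <= p <= 1)%R by have /andP[/ltW-> /ltW->] := p01.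
have := F2_young X p eta X1 p01'; rewrite (F2inv_quantileE Y p Y1 p01) -/eta.
have [_ p1] := andP p01'.
rewrite -(fineK (F2_fin_num X eta X1)) -(fineK (F2_fin_num Y eta Y1)).
rewrite -(fineK (F2inv_fin_num X p X1 p1)) -(fineK (F2inv_fin_num Y p Y1 p1)).
by rewrite -!EFinB -!EFinD !lee_fin; lra.
Qed.

End quantile.

Theorem theorem2 (d : measure_display) (T : measurableType d) (R : realType)
    (P : probability T R) (X Y : {RV P >-> R}) :
  atomless P ->
  (X : T -> R) \in Lfun P 1 ->
  (Y : T -> R) \in Lfun P 1 ->
  dist X (A2 Y) >=
    ereal_sup [set F2inv Y p - F2inv X p | p in `[0%R, 1%R]] /\
  ereal_sup [set F2inv Y p - F2inv X p | p in `[0%R, 1%R]] =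
    ereal_sup [set F2 X eta - F2 Y eta | eta in [set: R]].
Proof.
move=> _ X1 Y1; split.
  apply: le_ereal_inf_tmp => _ [Z [Z1 ZY] <-].
  apply: ge_ereal_sup => _ [p p01 <-]; rewrite /= in_itv/= in p01.
  apply: F2inv_sub_le p01 => // {}p p01.
  have [p0 p1] := andP p01.
  have := F2inv_le_W1 X Z p X1 Z1 (ltW p1).
  apply: le_trans; apply: leeB => //.
  (* Dominance, read at the single point eta = quantile Y p, yields F2inv Y p <= F2inv Z p. *)
  rewrite -sube_le0; apply: le_trans (F2inv_sub_le_F2 Z Y p Z1 Y1 p01) _.
  by rewrite sube_le0.
apply/eqP; rewrite eq_le; apply/andP; split; apply: ge_ereal_sup.
  move=> _ [p p01 <-]; rewrite /= in_itv/= in p01.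
  apply: F2inv_sub_le p01 => // {}p p01.
  apply: le_trans (F2inv_sub_le_F2 X Y p X1 Y1 p01) _.
  by apply: ereal_sup_ubound; exists (quantile Y p).
move=> _ [eta _ <-]; have [p p01 /le_trans] := F2_sub_le X Y eta X1 Y1; apply.
by apply: ereal_sup_ubound; exists p.
Qed.
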